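(* Let $\{x^k\}$ be the sequence generated by the extrapolated hard thresholding algorithm (described in the context) with $\epsilon>0$. Then $$\sum_{k=0}^{\infty}\|x^{k+1}-x^k\|\le \frac{1}{\epsilon}\Big(F(x^0)-\inf_{\Omega}F\Big)<+\infty .$$
   Context: Problem: minimize $F(x)=f(x)+\lambda_1\|x_+\|_0+\lambda_2\|x_-\|_0$ over $x\in\Omega$, where $\lambda_1>0$, $\lambda_2\ge 0$, $f:\mathbb{R}^n\to\mathbb{R}$ is a convex function whose gradient is $L_f$-Lipschitz continuous, $\|x_+\|_0$ (resp. $\|x_-\|_0$) is the number of indices $i$ with $x_i>0$ (resp. $x_i<0$), and $\Omega=\{x\in\mathbb{R}^n: l_i\le x_i\le u_i,\ i=1,\dots,n\}$ with $-\infty\le l_i\le 0\le u_i\le+\infty$, $l_i<u_i$. $\inf_\Omega F$ denotes $\inf_{x\in\Omega}F(x)$. $\|\cdot\|$ is the Euclidean norm, $\|\cdot\|_1$ the $\ell_1$ norm. Extrapolated hard thresholding algorithm: the parameters are $\epsilon\ge 0$, $\beta\ge 0$, $h>0$, $\gamma>0$ with $\gamma\ge \frac1h+(2\beta+h)L_f$; the initial points are $x^{-1}=x^0\in\Omega$. For $k=0,1,2,\dots$ compute $$v^k=\frac{1}{h(1+h\gamma)}(x^k-x^{k-1})-\frac{\beta}{1+h\gamma}\big(\nabla f(x^k)-\nabla f(x^{k-1})\big),\qquad z^k=v^k-\frac{h}{1+h\gamma}\nabla f(x^k),$$ and choose $$x^{k+1}\in x^k+h\cdot\arg\min_{y\in\Omega^k}Q(x^k,z^k,y),$$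 where $\Omega^k=\{y\in\mathbb{R}^n: \frac{l_i-x^k_i}{h}\le y_i\le\frac{u_i-x^k_i}{h},\ i=1,\dots,n\}$ and $$Q(x,z,y)=\frac{h\epsilon}{1+h\gamma}\|y\|_1+\frac{\lambda_1}{1+h\gamma}\|(x+hy)_+\|_0+\frac{\lambda_2}{1+h\gamma}\|(x+hy)_-\|_0+\frac12\|y-z\|^2 .$$
   Formalization: The final ''< +∞'' is proved under the assumption that inf_Ω F > −∞, which the text leaves implicit and without which it fails (e.g. f(x)=x on Ω=ℝ); the inequality itself is proved without this assumption, with right-hand side +∞ when inf_Ω F = −∞. *)

(* Defs.v *)
From HB Require Import structures.
From mathcomp Require Import all_boot all_order all_algebra.
From mathcomp Require Import all_classical all_reals all_analysis.
Set Implicit Arguments.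
Unset Strict Implicit.
Unset Printing Implicit Defensive.
Import Order.TTheory GRing.Theory Num.Theory.
Import numFieldNormedType.Exports.
Local Open Scope classical_set_scope.
Local Open Scope ring_scope.

(* The library norm on ['rV[R]_n] is the sup norm, so the Euclidean norm is
   introduced here; differentiability does not depend on this choice. *)
Definition norm2 {R : realType} {n : nat} (x : 'rV[R]_n) : R :=
  Num.sqrt (\sum_(i < n) x 0 i ^+ 2).

Definition norm1 {R : realType} {n : nat} (x : 'rV[R]_n) : R :=
  \sum_(i < n) `|x 0 i|.

(* [card_pos x] is ||x_+||_0 and [card_neg x] is ||x_-||_0. *)
Definition card_pos {R : realType} {n : nat} (x : 'rV[R]_n) : nat :=
  #|[set i : 'I_n | 0 < x 0 i]%SET|.

Definition card_neg {R : realType} {n : nat} (x : 'rV[R]_n) : nat :=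
  #|[set i : 'I_n | x 0 i < 0]%SET|.

Definition grad {R : realType} {n : nat} (f : 'rV[R]_n -> R) (x : 'rV[R]_n)
    : 'rV[R]_n :=
  \row_(i < n) 'D_(delta_mx 0 i) f x.

Definition lipschitz_gradient {R : realType} {n : nat} (L : R)
    (f : 'rV[R]_n -> R) : Prop :=
  (forall x, differentiable f x) /\
  (forall x y, norm2 (grad f x - grad f y) <= L * norm2 (x - y)).

Definition box {R : realType} {n : nat} (l u : 'I_n -> \bar R)
    : set 'rV[R]_n :=
  [set x | forall i, (l i <= (x 0 i)%:E <= u i)%E].

Definition argmin {R : realType} {T : Type} (D : set T) (G : T -> R) : set T :=
  [set y | D y /\ forall y', D y' -> G y <= G y'].

Definition objective {R : realType} {n : nat} (lambda1 lambda2 : R)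
    (f : 'rV[R]_n -> R) (x : 'rV[R]_n) : R :=
  f x + lambda1 * (card_pos x)%:R + lambda2 * (card_neg x)%:R.

Section Algorithm.
Context {R : realType} {n : nat}.
Variables (f : 'rV[R]_n -> R) (lambda1 lambda2 : R) (l u : 'I_n -> \bar R).
Variables (epsilon beta h gamma : R).

Definition eht_v (x xprev : 'rV[R]_n) : 'rV[R]_n :=
  (1 / (h * (1 + h * gamma))) *: (x - xprev)
  - (beta / (1 + h * gamma)) *: (grad f x - grad f xprev).

Definition eht_z (x xprev : 'rV[R]_n) : 'rV[R]_n :=
  eht_v x xprev - (h / (1 + h * gamma)) *: grad f x.

Definition eht_box (x : 'rV[R]_n) : set 'rV[R]_n :=
  box (fun i => ((l i - (x 0 i)%:E) * (h^-1)%:E)%E)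
      (fun i => ((u i - (x 0 i)%:E) * (h^-1)%:E)%E).

Definition eht_Q (x z y : 'rV[R]_n) : R :=
  h * epsilon / (1 + h * gamma) * norm1 y
  + lambda1 / (1 + h * gamma) * (card_pos (x + h *: y))%:R
  + lambda2 / (1 + h * gamma) * (card_neg (x + h *: y))%:R
  + 1 / 2 * norm2 (y - z) ^+ 2.

(* The convention x^{-1} = x^0 is encoded by the truncated predecessor:
   [x k.-1] is [x 0] when [k = 0]. *)
Definition eht_sequence (x : nat -> 'rV[R]_n) : Prop :=
  box l u (x 0) /\
  forall k : nat, exists2 y : 'rV[R]_n,
    argmin (eht_box (x k)) (eht_Q (x k) (eht_z (x k) (x k.-1))) y &
    x k.+1 = x k + h *: y.

End Algorithm.

(* Main.v *)
Require Import Defs.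
From HB Require Import structures.
From mathcomp Require Import all_boot all_order all_algebra.
From mathcomp Require Import all_classical all_reals all_analysis.
From mathcomp Require Import ring lra.
Import Order.TTheory GRing.Theory Num.Theory.
Import numFieldNormedType.Exports.
Local Open Scope classical_set_scope.
Local Open Scope ring_scope.

(** The iterates dissipate an energy. Write [q k = (x k - x (k-1)) / h] for the
    discrete velocity; the point of [argmin Q] chosen at step [k] is then
    [y = q (k+1)]. The zero displacement is feasible at every step because the
    iterates stay in the box, so [Q] at [y] is at most [Q] at [0]. Multiplied by
    [1 + h gamma], this comparison reads, with [g = grad f (x k)],
    [w = grad f (x k) - grad f (x (k-1))] and [P] the penalty
    [lambda1 |x_+|_0 + lambda2 |x_-|_0],
    [[
      h epsilon |y|_1 + P (x (k+1)) + (1 + h gamma) / 2 |y|^2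
        <= P (x k) + <y, q k> - beta <y, w> - h <y, g>.
    ]]
    The term [- h <y, g>] is traded for [f (x k) - f (x (k+1))] by the quadratic
    upper bound of [descent]; Cauchy-Schwarz, the Lipschitz bound and the
    arithmetic-geometric inequality bound the other two inner products by
    [(1 + beta h Lf) / 2 (|y|^2 + |q k|^2)]. The lower bound on [gamma] is
    precisely what makes the quadratic term on the left dominate
    [(1 + beta h Lf) |y|^2 + h^2 Lf / 2 |y|^2], where half of the first summand
    pays for the inner products and the other half is kept. What remains is
    [[
      h epsilon |y|_1 + F (x (k+1)) + c |y|^2 <= F (x k) + c |q k|^2,
      c = (1 + beta h Lf) / 2
    ]]
    ([energy_decrease]). Since [|x (k+1) - x k| = h |y| <= h |y|_1], telescoping
    bounds [epsilon] times each partial sum of the step lengths by the initial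
    energy, which is [F (x 0)] as [q 0 = 0], minus an energy that is at least
    [F (x N) >= inf F]. *)

(** * Euclidean geometry of row vectors *)

Definition dot {R : realType} {n : nat} (u v : 'rV[R]_n) : R :=
  \sum_(i < n) u 0 i * v 0 i.

Section EuclideanSpace.
Context {R : realType} {n : nat}.
Implicit Types (u v w : 'rV[R]_n) (c : R).

Lemma dotC u v : dot u v = dot v u.
Proof. by apply: eq_bigr => i _; rewrite mulrC. Qed.

Lemma dotDl u v w : dot (u + v) w = dot u w + dot v w.
Proof. by rewrite -big_split; apply: eq_bigr => i _; rewrite mxE mulrDl. Qed.

Lemma dotZl c u v : dot (c *: u) v = c * dot u v.
Proof. by rewrite /dot mulr_sumr; apply: eq_bigr => i _; rewrite mxE mulrA. Qed.

Lemma dotBl u v w : dot (u - v) w = dot u w - dot v w.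
Proof. by rewrite -scaleN1r dotDl dotZl mulN1r. Qed.

Lemma dotBr u v w : dot w (u - v) = dot w u - dot w v.
Proof. by rewrite !(dotC w) dotBl. Qed.

Lemma dotZr c u v : dot v (c *: u) = c * dot v u.
Proof. by rewrite !(dotC v) dotZl. Qed.

Lemma norm2_ge0 u : 0 <= norm2 u.
Proof. exact: sqrtr_ge0. Qed.

Lemma sqr_norm2 u : norm2 u ^+ 2 = dot u u.
Proof.
by rewrite sqr_sqrtr ?sumr_ge0// => i _; rewrite sqr_ge0.
Qed.

Lemma norm2_eq0 u : norm2 u = 0 -> u = 0.
Proof.
move=> u0; have /eqP := sqr_norm2 u.
rewrite u0 expr0n /= eq_sym psumr_eq0 => [/allP us|i _]; last exact: sqr_ge0.
apply/rowP => i; rewrite mxE; apply/eqP.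
by have := us i (mem_index_enum i); rewrite /= mulf_eq0 orbb.
Qed.

Lemma norm2Z c u : 0 <= c -> norm2 (c *: u) = c * norm2 u.
Proof.
move=> c0; apply/eqP; rewrite -(eqrXn2 (n := 2)) ?mulr_ge0 ?norm2_ge0//.
by rewrite exprMn !sqr_norm2 dotZl dotZr; apply/eqP; ring.
Qed.

Lemma norm2N u : norm2 (- u) = norm2 u.
Proof. by congr Num.sqrt; apply: eq_bigr => i _; rewrite mxE sqrrN. Qed.

Lemma norm2_le_norm1 u : norm2 u <= norm1 u.
Proof.
have S0 : 0 <= norm1 u by exact: sumr_ge0.
rewrite -[leRHS](ger0_norm S0) -sqrtr_sqr ler_wsqrtr// [leRHS]expr2.
rewrite {2}/norm1 mulr_suml; apply: ler_sum => i _.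
rewrite -real_normK ?num_real// expr2 ler_wpM2l//.
by rewrite /norm1 (bigD1 i)//= lerDl sumr_ge0.
Qed.

Lemma sqr_norm2B u v :
  norm2 (u - v) ^+ 2 = norm2 u ^+ 2 - 2 * dot u v + norm2 v ^+ 2.
Proof. by rewrite !sqr_norm2 !(dotBl, dotBr) (dotC v u); ring. Qed.

(** Expanding the square of [norm2 v *: u - norm2 u *: v] gives
    [2 |u| |v| (|u| |v| - <u, v>)], which is nonnegative. *)
Lemma dot_le_norm2 u v : dot u v <= norm2 u * norm2 v.
Proof.
have [/norm2_eq0 ->|u0] := eqVneq (norm2 u) 0.
  rewrite -(scale0r (0 : 'rV[R]_n)) dotZl mul0r.
  by rewrite mulr_ge0 ?norm2_ge0.
have [/norm2_eq0 ->|v0] := eqVneq (norm2 v) 0.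
  rewrite -(scale0r (0 : 'rV[R]_n)) dotZr mul0r.
  by rewrite mulr_ge0 ?norm2_ge0.
have uv0 : 0 < norm2 u * norm2 v by rewrite mulr_gt0// lt_def norm2_ge0 ?u0 ?v0.
have := sqr_ge0 (norm2 (norm2 v *: u - norm2 u *: v)).
rewrite sqr_norm2 !(dotBl, dotBr, dotZl, dotZr) -!sqr_norm2 (dotC v u) => sq0.
by rewrite -subr_ge0 -(pmulr_rge0 _ uv0); nra.
Qed.

End EuclideanSpace.

(** * Functions with Lipschitz gradient *)

Section Gradient.
Context {R : realType} {n : nat}.
Implicit Types (f : 'rV[R]_n -> R) (x d : 'rV[R]_n) (L : R).

Lemma derive_grad f x d : differentiable f x -> 'D_d f x = dot d (grad f x).
Proof.
move=> fx; rewrite deriveE// {1}(row_sum_delta d) linear_sum.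
by apply: eq_bigr => i _; rewrite linearZ mxE deriveE.
Qed.

(** The difference quotients of [s |-> f (x + s d)] at [t] are those of the
    directional derivative of [f] along [d] at [x + t d]. *)
Lemma is_derive_line f x d (t : R) : differentiable f (x + t *: d) ->
  is_derive t 1 (fun s => f (x + s *: d)) (dot d (grad f (x + t *: d))).
Proof.
move=> fx.
have shift : (fun h : R => h^-1 *: (f (x + (h *: 1 + t) *: d) - f (x + t *: d)))
  = (fun h : R => h^-1 *: (f (h *: d + (x + t *: d)) - f (x + t *: d))).
  apply/funext => h; congr (_ *: (f _ - _)).
  by rewrite scalerDl /GRing.scale /= mulr1 addrCA.
apply: DeriveDef.
  by rewrite /derivable shift; exact: diff_derivable.
by rewrite -derive_grad// /derive shift.
Qed.

(** The bound [0 <= L |v|] leaves room for a negative constant in dimension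
    zero only, where every norm vanishes. *)
Lemma lipschitz_const_ge0 L f : lipschitz_gradient L f ->
  0 <= L \/ forall v : 'rV[R]_n, norm2 v = 0.
Proof.
move=> [_ lip]; have [L0|L0] := leP 0 L; [by left|right=> v].
have Lv : 0 <= L * norm2 v.
  by have := lip v 0; rewrite subr0; apply: le_trans; exact: norm2_ge0.
apply/eqP; rewrite eq_le norm2_ge0 andbT.
by rewrite -(nmulr_rge0 _ L0).
Qed.

Lemma lipschitz_grad_dot L f x v d : lipschitz_gradient L f ->
  dot d (grad f x - grad f v) <= L * (norm2 d * norm2 (x - v)).
Proof.
move=> [_ lip]; apply: le_trans (dot_le_norm2 _ _) _.
by rewrite mulrCA ler_wpM2l ?norm2_ge0.
Qed.

(** Along the segment from [x] to [x + d], the defect of the quadratic upper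
    bound has derivative [<grad f (x + t d) - grad f x, d> - L t |d|^2], which
    is nonpositive by the Lipschitz bound. *)
Lemma descent L f x d : lipschitz_gradient L f ->
  f (x + d) <= f x + dot d (grad f x) + L / 2 * norm2 d ^+ 2.
Proof.
move=> Lf; have [fdiff _] := Lf.
pose G := dot d (grad f x); pose K := L / 2 * norm2 d ^+ 2.
pose phi (t : R) := f (x + t *: d) - (t * G + t ^+ 2 * K).
pose dphi (t : R) := dot d (grad f (x + t *: d)) - (G + t *+ 2 * K).
have phiD (t : R) : is_derive t 1 phi (dphi t).
  have := is_derive_line f x d t (fdiff _) => H.
  rewrite /phi /dphi; apply: is_derive_eq.
  by rewrite /GRing.scale /=; ring.
have phi_le : phi 1 <= phi 0.
  apply: (@ler0_derive1_le_cc R phi 0 1); rewrite ?in_itv /= ?lexx ?ler01 //.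
  - move=> t; rewrite in_itv /= => /andP[t0 _].
    rewrite derive1E derive_val /dphi /G.
    have := lipschitz_grad_dot L f (x + t *: d) x d Lf.
    rewrite [x + _]addrC addrK norm2Z ?(ltW t0)// dotBr /K mulr2n; lra.
  - apply: derivable_within_continuous => t _.
    exact: (@ex_derive _ _ _ _ _ _ _ (phiD t)).
by move: phi_le; rewrite /phi scale1r scale0r addr0 -/G -/K; lra.
Qed.

End Gradient.

(** * Energy dissipation in one step *)

Section Step.
Context {R : realType} {n : nat}.
Variables (f : 'rV[R]_n -> R) (Lf lambda1 lambda2 : R) (l u : 'I_n -> \bar R).
Variables (epsilon beta h gamma : R).
Hypothesis (f_lip : lipschitz_gradient Lf f).
Hypotheses (beta_ge0 : 0 <= beta) (h_gt0 : 0 < h) (gamma_gt0 : 0 < gamma).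
Hypothesis gamma_ge : h^-1 + (2 * beta + h) * Lf <= gamma.

Lemma eht_boxE (x y : 'rV[R]_n) : eht_box l u h x y <-> box l u (x + h *: y).
Proof.
have E i : ((l i - (x 0 i)%:E) * (h^-1)%:E <= (y 0 i)%:E <=
    (u i - (x 0 i)%:E) * (h^-1)%:E)%E =
  (l i <= ((x + h *: y) 0 i)%:E <= u i)%E.
  rewrite lee_pdivrMr// lee_pdivlMr// leeBlDr// leeBrDr// -EFinM -EFinD.
  by rewrite !mxE [h * _]mulrC addrC.
by split=> H i; have := H i; rewrite /= E.
Qed.

(** [q] stands for the discrete velocity [(x k - x (k-1)) / h]; the weight of
    the kinetic term is the one that telescopes, namely the coefficient of
    [|q|^2] after the inner products of the optimality inequality are split. *)
Definition energy (x q : 'rV[R]_n) : R :=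
  objective lambda1 lambda2 f x + (1 + beta * h * Lf) / 2 * norm2 q ^+ 2.

Lemma energy_ge_objective x q : objective lambda1 lambda2 f x <= energy x q.
Proof.
rewrite lerDl; have [L0|->] := lipschitz_const_ge0 Lf f f_lip.
  by rewrite mulr_ge0 ?sqr_ge0// divr_ge0// addr_ge0// !mulr_ge0// ltW.
by rewrite expr0n mulr0.
Qed.

(** Compare the minimizer [y] with the feasible point [0]; the previous iterate
    is written [x - h q] so that both displacements scale with [h]. *)
Lemma energy_decrease (x q y : 'rV[R]_n) : box l u x ->
  argmin (eht_box l u h x)
    (eht_Q lambda1 lambda2 epsilon h gamma x
      (eht_z f beta h gamma x (x - h *: q))) y ->
  h * epsilon * norm1 y + energy (x + h *: y) y <= energy x q.
Proof.
move=> xbox [_ /(_ 0)].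
rewrite eht_boxE scaler0 addr0 => /(_ xbox).
have a_gt0 : 0 < 1 + h * gamma by rewrite addr_gt0// mulr_gt0.
have a0 : 1 + h * gamma != 0 by rewrite gt_eqF.
have h0 : h != 0 by rewrite gt_eqF.
rewrite /eht_Q sub0r norm2N scaler0 addr0 sqr_norm2B.
have -> : norm1 (0 : 'rV[R]_n) = 0.
  by rewrite /norm1 big1// => i _; rewrite mxE normr0.
set z := eht_z _ _ _ _ _ _.
set p' := (card_pos (x + h *: y))%:R; set n' := (card_neg (x + h *: y))%:R.
set p := (card_pos x)%:R; set m := (card_neg x)%:R.
pose w := grad f x - grad f (x - h *: q).
have yz : dot y z =
    (dot y q - beta * dot y w - h * dot y (grad f x)) / (1 + h * gamma).
  rewrite /z /eht_z /eht_v -/w subKr !(dotBr, dotZr).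
  by field; rewrite a0 h0.
rewrite yz mulr0 add0r -(ler_pM2l a_gt0).
(* Once the denominator is cleared, [opt] is linear in the inner products and
   squared norms that the bounds after it control. *)
set lhs := (X in X <= _); set rhs := (X in _ <= X) => opt.
have {lhs rhs} opt : h * epsilon * norm1 y + lambda1 * p' + lambda2 * n'
   + (1 + h * gamma) / 2 * norm2 y ^+ 2
   - (dot y q - beta * dot y w - h * dot y (grad f x))
   <= lambda1 * p + lambda2 * m.
  rewrite -subr_ge0.
  suff -> : lambda1 * p + lambda2 * m - (h * epsilon * norm1 y + lambda1 * p' +
    lambda2 * n' + (1 + h * gamma) / 2 * norm2 y ^+ 2
   - (dot y q - beta * dot y w - h * dot y (grad f x))) = rhs - lhs.
    by rewrite subr_ge0.
  by rewrite /rhs /lhs; field.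
have desc := descent Lf f x (h *: y) f_lip.
rewrite norm2Z ?(ltW h_gt0)// dotZl in desc.
have cs := dot_le_norm2 y q.
have lipw : - dot y w <= Lf * (norm2 y * (h * norm2 q)).
  have := lipschitz_grad_dot Lf f (x - h *: q) x y f_lip.
  rewrite -opprB -/w addrAC subrr add0r norm2N norm2Z ?(ltW h_gt0)//.
  by rewrite -scaleN1r dotZr mulN1r.
have gammaY : (1 + (2 * beta + h) * h * Lf) * norm2 y ^+ 2
    <= h * gamma * norm2 y ^+ 2.
  rewrite ler_wpM2r ?sqr_ge0//.
  have := ler_wpM2l (ltW h_gt0) gamma_ge; apply: le_trans.
  by rewrite mulrDr mulfV//; lra.
have sq0 := sqr_ge0 (norm2 y - norm2 q).
have Lsq0 : 0 <= beta * h * Lf * (norm2 y - norm2 q) ^+ 2.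
  have [L0|n0] := lipschitz_const_ge0 Lf f f_lip.
    by rewrite mulr_ge0 ?sqr_ge0// !mulr_ge0// ltW.
  by rewrite !n0 subrr expr0n mulr0.
have := ler_wpM2l beta_ge0 lipw.
rewrite /energy /objective -/p' -/n' -/p -/m; lra.
Qed.

End Step.

(** * Summability of the step lengths *)

Theorem theorem4p1 (R : realType) (n : nat)
  (f : 'rV[R]_n -> R) (Lf lambda1 lambda2 : R) (l u : 'I_n -> \bar R)
  (epsilon beta h gamma : R) (x : nat -> 'rV[R]_n)
  (lambda1_gt0 : 0 < lambda1) (lambda2_ge0 : 0 <= lambda2)
  (f_convex : convex_function [set: convex_lmodType 'rV[R]_n] f)
  (f_lip : lipschitz_gradient Lf f)
  (bounds : forall i, [/\ (l i <= 0)%E, (0 <= u i)%E & (l i < u i)%E])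
  (epsilon_gt0 : 0 < epsilon) (beta_ge0 : 0 <= beta) (h_gt0 : 0 < h)
  (gamma_gt0 : 0 < gamma)
  (gamma_ge : h^-1 + (2 * beta + h) * Lf <= gamma)
  (x_eht : eht_sequence f lambda1 lambda2 l u epsilon beta h gamma x) :
  let F := objective lambda1 lambda2 f in
  let infF := ereal_inf [set (F y)%:E | y in box l u] in
  let rhs := ((epsilon^-1)%:E * ((F (x 0%N))%:E - infF))%E in
  (\sum_(0 <= k <oo) (norm2 (x k.+1 - x k))%:E <= rhs)%E
  /\ ((-oo < infF)%E -> (rhs < +oo)%E).
Proof.
move=> F infF rhs.
have [x0box step] := x_eht.
pose q k := h^-1 *: (x k - x k.-1).
have h0 : h != 0 by rewrite gt_eqF.
have qE k : x k.-1 = x k - h *: q k by rewrite scalerA mulfV// scale1r subKr.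
have next k : argmin (eht_box l u h (x k)) (eht_Q lambda1 lambda2 epsilon h
    gamma (x k) (eht_z f beta h gamma (x k) (x k - h *: q k))) (q k.+1).
  have [y ymin xS] := step k.
  rewrite -qE; suff -> : q k.+1 = y by [].
  by rewrite /q /= xS addrAC subrr add0r scalerA mulVf// scale1r.
have xS k : x k.+1 = x k + h *: q k.+1.
  by rewrite scalerA mulfV// scale1r addrC subrK.
have xbox k : box l u (x k).
  elim: k => [//|k _]; rewrite xS; apply/eht_boxE => //.
  by case: (next k).
pose E k := energy f Lf lambda1 lambda2 beta h (x k) (q k).
have decr k : epsilon * norm2 (x k.+1 - x k) <= E k - E k.+1.
  have := @energy_decrease R n f Lf lambda1 lambda2 l u epsilon beta h gamma
    f_lip beta_ge0 h_gt0 gamma_gt0 gamma_ge (x k) (q k) (q k.+1) (xbox k) (next k).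
  rewrite -xS -/(E k) -/(E k.+1).
  rewrite xS addrAC subrr add0r norm2Z ?(ltW h_gt0)//.
  have : h * epsilon * norm2 (q k.+1) <= h * epsilon * norm1 (q k.+1).
    by rewrite ler_wpM2l ?norm2_le_norm1// mulr_ge0 ?ltW.
  lra.
(* [x (0.-1)] is [x 0], hence the initial velocity vanishes. *)
have E0 : E 0%N = F (x 0%N).
  rewrite /E /energy /q subrr scaler0 sqr_norm2 -(scale0r 0) dotZl mul0r mulr0.
  by rewrite addr0.
have psum N : epsilon * (\sum_(0 <= k < N) norm2 (x k.+1 - x k)) <=
    F (x 0%N) - F (x N).
  apply: (@le_trans _ _ (E 0%N - E N)).
    rewrite mulr_sumr -[leRHS]opprB -telescope_sumr// -sumrN.
    by apply: ler_sum => k _; rewrite opprB.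
  by rewrite E0 lerD2l lerN2 energy_ge_objective.
have infF_le k : (infF <= (F (x k))%:E)%E.
  by apply: ereal_inf_lbound; exists (x k).
split.
  apply: lime_le.
    by apply: is_cvg_nneseries => k _ _; rewrite lee_fin norm2_ge0.
  apply: nearW => N; rewrite sumEFin /rhs muleC lee_pdivlMr// -EFinM.
  apply: (@le_trans _ _ ((F (x 0%N))%:E - (F (x N))%:E)%E).
    by rewrite -EFinB lee_fin mulrC.
  exact: leeB.
move=> infF_gt; have := infF_le 0%N; rewrite /rhs.
case: infF infF_gt {infF_le rhs} => [r _ _|//|//].
by rewrite -EFinB -EFinM ltry.
Qed.
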